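(* For any $\lambda,\epsilon\in\left(0,\frac12\right)$, there exists a positive semidefinite matrix $A$ with spectral norm $1$, eigengap $\lambda$, and (unit) leading eigenvector $\mathbf{v}_1$, as well as a unit vector $\mathbf{w}_0$ for which $\|\mathbf{v}_1-\mathbf{w}_0\|\le\sqrt{2(1+\epsilon)\lambda}$, such that the function $F_A(\mathbf{w})=-\frac{\mathbf{w}^\top A\mathbf{w}}{\|\mathbf{w}\|^2}$ is not convex in any neighborhood of $\mathbf{w}_0$ on the hyperplane $H_{\mathbf{w}_0}=\{\mathbf{w}:\langle\mathbf{w},\mathbf{w}_0\rangle=1\}$.
   Context: The eigengap is the difference between the largest and second largest eigenvalues of $A$. *)

(* Defs.v *)
From HB Require Import structures.
From mathcomp Require Import all_boot all_order all_algebra.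
From mathcomp Require Import all_classical all_reals all_analysis.

Set Implicit Arguments.
Unset Strict Implicit.
Unset Printing Implicit Defensive.

Import Order.TTheory GRing.Theory Num.Theory.
Import numFieldNormedType.Exports.

Local Open Scope classical_set_scope.
Local Open Scope ring_scope.

Definition dotv (R : realType) (n : nat) (u v : 'cV[R]_n) : R :=
  (u^T *m v) 0 0.

(* The norm that ['cV[R]_n] inherits is the sup norm, hence this one; both
   induce the entrywise topology used by [nbhs]. *)
Definition enorm (R : realType) (n : nat) (u : 'cV[R]_n) : R :=
  Num.sqrt (dotv u u).

Definition psdmx (R : realType) (n : nat) (A : 'M[R]_n) : Prop :=
  A^T = A /\ forall x : 'cV[R]_n, 0 <= dotv x (A *m x).

Definition spectral_norm (R : realType) (n : nat) (A : 'M[R]_n) : R :=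
  sup [set enorm (A *m x) | x in [set x : 'cV[R]_n | enorm x <= 1]].

(* [s] lists the eigenvalues of [A] in nonincreasing order, repeated according
   to multiplicity; there is at most one such list (and its size is [n]). *)
Definition eigenvalue_list (R : realType) (n : nat) (A : 'M[R]_n) (s : seq R) :
    Prop :=
  sorted >=%R s /\ char_poly A = \prod_(a <- s) ('X - a%:P).

Definition has_eigengap (R : realType) (n : nat) (A : 'M[R]_n) (g : R) : Prop :=
  exists s : seq R,
    [/\ eigenvalue_list A s, (1 < size s)%N & s`_0 - s`_1 = g].

(* [eigenvalue] refers to left (row) eigenvectors; left and right eigenvalues
   coincide. *)
Definition leading_eigenvector (R : realType) (n : nat) (A : 'M[R]_n)
    (v : 'cV[R]_n) : Prop :=
  v != 0 /\
  exists2 a : R, A *m v = a *: v & forall b : R, eigenvalue A b -> b <= a.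

(* By the convention [x / 0 = 0] this is [0] at [w = 0], which does not lie on
   any of the hyperplanes [hyperplane w0]. *)
Definition neg_rayleigh (R : realType) (n : nat) (A : 'M[R]_n) (w : 'cV[R]_n) :
    R :=
  - (dotv w (A *m w) / enorm w ^+ 2).

Definition hyperplane (R : realType) (n : nat) (w0 : 'cV[R]_n) :
    set 'cV[R]_n :=
  [set w | dotv w w0 = 1].

(* Main.v *)
(** If [z] is a unit vector orthogonal to the unit vector [w0], then [w0 + t z]
    and [w0 - t z] lie on the hyperplane of [w0] and the mean of the Rayleigh
    quotients there is [(a + t^2 b) / (1 + t^2)], with [a] and [b] the Rayleigh
    quotients of [w0] and [z]. Hence [a < b] contradicts midpoint convexity at
    [w0] at every scale. Take [A = diag(1, 1 - lambda, 0)], [z = e_2] and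
    [w0 = c e_1 + sqrt (1 - c^2) e_3] with [c = 1 - (1 + eps) lambda], so that
    [|e_1 - w0|^2 = 2 (1 - c)]; the condition [c^2 < 1 - lambda] amounts to
    [(1 + eps)^2 lambda < 1 + 2 eps]. *)
Require Import Defs.
From mathcomp Require Import all_boot all_order all_algebra.
From mathcomp Require Import all_classical all_reals all_analysis.
From mathcomp Require Import ring lra.

Import Order.TTheory GRing.Theory Num.Theory.
Import numFieldNormedType.Exports.

Local Open Scope classical_set_scope.
Local Open Scope ring_scope.

Lemma dotvE {R : realType} {n : nat} (u v : 'cV[R]_n) :
  dotv u v = \sum_i u i 0 * v i 0.
Proof. by rewrite /dotv mxE; apply: eq_bigr => i _; rewrite mxE. Qed.

Lemma dotvDl {R : realType} {n : nat} (u v w : 'cV[R]_n) :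
  dotv (u + v) w = dotv u w + dotv v w.
Proof. by rewrite /dotv linearD mulmxDl mxE. Qed.

Lemma dotvDr {R : realType} {n : nat} (u v w : 'cV[R]_n) :
  dotv w (u + v) = dotv w u + dotv w v.
Proof. by rewrite /dotv mulmxDr mxE. Qed.

Lemma dotvZl {R : realType} {n : nat} (a : R) (u v : 'cV[R]_n) :
  dotv (a *: u) v = a * dotv u v.
Proof. by rewrite /dotv linearZ /= -scalemxAl mxE. Qed.

Lemma dotvZr {R : realType} {n : nat} (a : R) (u v : 'cV[R]_n) :
  dotv u (a *: v) = a * dotv u v.
Proof. by rewrite /dotv -scalemxAr mxE. Qed.

Lemma dotvC {R : realType} {n : nat} (u v : 'cV[R]_n) : dotv u v = dotv v u.
Proof. by rewrite !dotvE; apply: eq_bigr => i _; rewrite mulrC. Qed.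

Lemma dotvv_ge0 {R : realType} {n : nat} (u : 'cV[R]_n) : 0 <= dotv u u.
Proof. by rewrite dotvE sumr_ge0 // => i _; rewrite -expr2 sqr_ge0. Qed.

Lemma dotv_delta {R : realType} {n : nat} (i : 'I_n) (u : 'cV[R]_n) :
  dotv (delta_mx i 0) u = u i 0.
Proof.
rewrite dotvE (bigD1 i) //= mxE !eqxx mul1r big1 ?addr0 // => j /negbTE ji.
by rewrite mxE ji mul0r.
Qed.

Lemma enorm_delta {R : realType} {n : nat} (i : 'I_n) :
  enorm (delta_mx i 0 : 'cV[R]_n) = 1.
Proof. by rewrite /enorm dotv_delta mxE !eqxx sqrtr1. Qed.

Lemma neg_rayleigh_not_convex {R : realType} {n : nat} (A : 'M[R]_n)
    (w0 z : 'cV[R]_n) (U : set 'cV[R]_n) :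
  dotv w0 w0 = 1 -> dotv z z = 1 -> dotv w0 z = 0 ->
  dotv w0 (A *m w0) < dotv z (A *m z) -> nbhs w0 U ->
  ~ convex_function (U `&` hyperplane w0) (neg_rayleigh A).
Proof.
move=> w1 z1 wz aLb w0U cvxF.
pose p t : 'cV[R]_n := w0 + t *: z.
(* Continuity of the line through [w0] turns the neighborhood [U] into an interval of admissible
   parameters around 0, so small symmetric steps stay in [U]. *)
have p_cvg : p t @[t --> 0] --> w0.
  rewrite -[X in _ --> X]addr0 -[in X in _ --> X](scale0r z).
  by apply: cvgD; [exact: cvg_cst|apply: cvgZr_tmp; exact: cvg_id].
have [e /= e0 pU] : exists2 e : R, 0 < e & forall t, `|t| < e -> U (p t).
  have /nbhs_ballP[e /= e0 eU] := p_cvg _ w0U.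
  by exists e => // t te; apply: eU; rewrite /ball /= sub0r normrN.
have pH t : hyperplane w0 (p t).
  by rewrite /hyperplane /= dotvDl dotvZl w1 (dotvC z w0) wz mulr0 addr0.
pose t := e / 2.
have t0 : 0 < t by rewrite divr_gt0.
have te : t < e by rewrite /t; lra.
have Dp s : s \in [set t; - t] -> p s \in U `&` hyperplane w0.
  move=> /set_mem sE; apply/mem_set; split; last exact: pH.
  by apply: pU; case: sE => ->; rewrite ?normrN gtr0_norm.
(* The cross term is odd in [s] while the denominator is even, so averaging over [t] and [- t]
   cancels it; symmetry of [A] is not assumed. *)
have Fp s : neg_rayleigh A (p s) = - ((dotv w0 (A *m w0) +
    s * (dotv w0 (A *m z) + dotv z (A *m w0)) + s ^+ 2 * dotv z (A *m z))
    / (1 + s ^+ 2)).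
  rewrite /neg_rayleigh sqr_sqrtr ?dotvv_ge0 // /p mulmxDr -scalemxAr.
  rewrite !(dotvDl, dotvDr, dotvZl, dotvZr) w1 z1 (dotvC z w0) wz.
  by congr (- (_ / _)); ring.
have half01 : 0 <= (2^-1 : R) <= 1 by lra.
have tD : p t \in U `&` hyperplane w0 by apply: Dp; apply/mem_set; left.
have mtD : p (- t) \in U `&` hyperplane w0 by apply: Dp; apply/mem_set; right.
have [h0 h1] := andP half01.
have mid : 2^-1 *: p t + (1 - 2^-1) *: p (- t) = p 0.
  by apply/matrixP => i j; rewrite !mxE; field.
have := cvxF (Itv01 h0 h1) _ _ tD mtD.
rewrite convRE /= /conv /= /unstable.onem mid !Fp sqrrN expr0n /= !mul0r !addr0.
rewrite divr1 leNgt => /negP; apply.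
set a := dotv w0 (A *m w0); set b := dotv z (A *m z).
set k := _ + dotv z _.
have t2_gt0 : 0 < t ^+ 2 by rewrite exprn_gt0.
have t21_gt0 : 0 < 1 + t ^+ 2 by rewrite addr_gt0.
(* The average of the endpoint values lies below the midpoint value [- a] by a positive amount, as
   [a < b]. *)
rewrite [ltLHS](_ : _ = - a - t ^+ 2 * (b - a) / (1 + t ^+ 2)).
  by rewrite gtrDl oppr_lt0 divr_gt0 // mulr_gt0 // subr_gt0.
by field; rewrite gt_eqF.
Qed.

Lemma diag_mulE {R : realType} {n : nat} (d : 'rV[R]_n) (x : 'cV[R]_n) i : (diag_mx d *m x) i 0 = d 0 i * x i 0.
Proof. by rewrite mul_diag_mx mxE. Qed.

Lemma dotv_diag {R : realType} {n : nat} (d : 'rV[R]_n) (x : 'cV[R]_n) :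
  dotv x (diag_mx d *m x) = \sum_i d 0 i * x i 0 ^+ 2.
Proof. by rewrite dotvE; apply: eq_bigr => i _; rewrite diag_mulE; ring. Qed.

Lemma psdmx_diag {R : realType} {n : nat} (d : 'rV[R]_n) : (forall i, 0 <= d 0 i) -> psdmx (diag_mx d).
Proof.
move=> d0; split=> [|x]; first by rewrite tr_diag_mx.
by rewrite dotv_diag sumr_ge0 // => i _; rewrite mulr_ge0 ?sqr_ge0.
Qed.

Lemma char_poly_diag {R : realType} {n : nat} (d : 'rV[R]_n) : char_poly (diag_mx d) = \prod_i ('X - (d 0 i)%:P).
Proof.
rewrite char_poly_trig ?diag_mx_is_trig //.
by apply: eq_bigr => i _; rewrite mxE eqxx mulr1n.
Qed.

Lemma diag_mul_delta {R : realType} {n : nat} (d : 'rV[R]_n) i :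
  diag_mx d *m delta_mx i 0 = d 0 i *: delta_mx i 0 :> 'cV[R]_n.
Proof.
apply/matrixP => j k; rewrite ord1 diag_mulE !mxE eqxx andbT.
by case: eqP => [->|]; rewrite ?mulr0.
Qed.

Lemma leading_eigenvector_diag {R : realType} {n : nat} (d : 'rV[R]_n) i : (forall j, d 0 j <= d 0 i) ->
  leading_eigenvector (diag_mx d) (delta_mx i 0).
Proof.
move=> di; split.
  by apply/eqP => /matrixP /(_ i 0) /eqP; rewrite !mxE !eqxx oner_eq0.
exists (d 0 i); first exact: diag_mul_delta.
move=> b; rewrite eigenvalue_root_char char_poly_diag.
(* Reindexing by the diagonal entries themselves exhibits the roots as exactly those entries. *)
rewrite -(big_map (d 0) predT (fun a => 'X - a%:P)) root_prod_XsubC.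
by move=> /mapP[j _ ->].
Qed.

(** The supremum is attained at the [i]-th basis vector; the upper bound follows by comparing
    squared norms entry by entry. *)
Lemma spectral_norm_diag {R : realType} {n : nat} (d : 'rV[R]_n) i : (forall j, `|d 0 j| <= d 0 i) ->
  spectral_norm (diag_mx d) = d 0 i.
Proof.
move=> di; have di0 : 0 <= d 0 i by exact: le_trans (di i).
rewrite /spectral_norm; set E := (X in sup X).
have Ei : E (d 0 i).
  exists (delta_mx i 0); first by rewrite /= enorm_delta.
  rewrite diag_mul_delta /enorm dotvZl dotvZr dotv_delta mxE !eqxx mulr1.
  by rewrite -expr2 sqrtr_sqr ger0_norm.
have ubE : ubound E (d 0 i).
  move=> _ [x /= x1 <-]; rewrite -[leRHS]mulr1.
  apply: le_trans (ler_wpM2l di0 x1); rewrite -[X in X * _]ger0_norm //.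
  rewrite -sqrtr_sqr /enorm -sqrtrM ?sqr_ge0 // ler_wsqrtr // !dotvE mulr_sumr.
  apply: ler_sum => j _; rewrite diag_mulE -!expr2 exprMn ler_wpM2r ?sqr_ge0 //.
  by rewrite -[leLHS]real_normK ?num_real // lerXn2r ?nnegrE.
apply/eqP; rewrite eq_le ge_sup //=; last by exists (d 0 i).
by apply: ub_le_sup => //; exists (d 0 i).
Qed.

Theorem theorem5 (R : realType) (lambda eps : R)
    (hlambda : 0 < lambda < 2^-1) (heps : 0 < eps < 2^-1) :
  exists (n : nat) (A : 'M[R]_n) (v1 w0 : 'cV[R]_n),
    [/\ psdmx A, spectral_norm A = 1 & has_eigengap A lambda] /\
    [/\ leading_eigenvector A v1, enorm v1 = 1 & enorm w0 = 1] /\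
    enorm (v1 - w0) <= Num.sqrt (2 * (1 + eps) * lambda) /\
    forall U : set 'cV[R]_n, nbhs w0 U ->
      ~ convex_function (U `&` hyperplane w0) (neg_rayleigh A).
Proof.
have /andP[l0 l2] := hlambda; have /andP[e0 e2] := heps.
pose c := 1 - (1 + eps) * lambda; pose s := Num.sqrt (1 - c ^+ 2).
(* Here [(1 + eps) * lambda] is below 3/4. *)
have c01 : 0 < c < 1 by rewrite /c; apply/andP; split; nra.
have sE : s ^+ 2 = 1 - c ^+ 2 by rewrite sqr_sqrtr //; nra.
have c2 : c ^+ 2 < 1 - lambda.
  (* Since [lambda < 1/2], it suffices that [(1 + eps)^2 <= 2 (1 + 2 eps)], that is,
     [eps^2 <= 1 + 2 eps]. *)
  have gap : 0 < 1 + 2 * eps - (1 + eps) ^+ 2 * lambda by nra.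
  rewrite -subr_gt0 [ltRHS](_ : _ =
    lambda * (1 + 2 * eps - (1 + eps) ^+ 2 * lambda)) ?mulr_gt0 //.
  by rewrite /c; ring.
pose d : 'rV[R]_3 := \row_i [:: 1; 1 - lambda; 0]`_i.
pose w0 : 'cV[R]_3 := \col_i [:: c; 0; s]`_i.
have d01 i : 0 <= d 0 i <= 1.
  by rewrite mxE; case: i => [[|[|[|//]]] ?] /=; lra.
have d00 : d 0 0 = 1 by rewrite mxE.
have w1 : dotv w0 w0 = 1.
  by rewrite dotvE !big_ord_recl big_ord0 !mxE /= -[s * s]expr2 sE; ring.
exists 3%N, (diag_mx d), (delta_mx 0 0), w0; split; last split; last split.
- split.
  + by apply: psdmx_diag => i; case/andP: (d01 i).
  + rewrite -d00; apply: spectral_norm_diag => i; rewrite d00.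
    by case/andP: (d01 i) => di0 di1; rewrite ger0_norm.
  + exists [:: 1; 1 - lambda; 0]; split=> //=; last by ring.
    split; first by rewrite /= !andbT; lra.
    rewrite char_poly_diag !big_cons big_nil !big_ord_recl big_ord0.
    by rewrite !mxE.
- split; last by rewrite /enorm w1 sqrtr1.
  + by apply: leading_eigenvector_diag => i; rewrite d00; case/andP: (d01 i).
  + exact: enorm_delta.
(* The bound is an equality: [(1 - c)^2 + s^2 = 2 (1 - c) = 2 (1 + eps) lambda]. *)
- rewrite ler_wsqrtr // dotvE !big_ord_recl big_ord0 !mxE /=.
  rewrite subr0 mulr0 sub0r mulrNN -[s * s]expr2 sE.
  by rewrite [leLHS](_ : _ = 2 * (1 - c)) /c; [lra|ring].
- move=> U; apply: (@neg_rayleigh_not_convex _ _ _ _ (delta_mx 1 0)) => //.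
  + by rewrite dotv_delta mxE.
  + by rewrite dotvC dotv_delta mxE.
  (* The eigenvalue 0 on the third axis leaves [c^2] as the Rayleigh quotient of [w0], against
     [1 - lambda] for the second axis, so [c2] concludes. *)
  + rewrite !dotv_diag !big_ord_recl !big_ord0 !mxE /= expr0n /=.
    lra.
Qed.
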